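(* Let $(X,P,\mu)$ be a branching Markov chain, let $c>0$ and define $C:=\{x\in X:\ \alpha(x)\geq c\}$. If the set $C$ is recurrent with respect to the Markov chain $(X,P)$, i.e., the trajectory of the Markov chain with transition matrix $P$ almost surely hits $C$ infinitely often, then the branching Markov chain $(X,P,\mu)$ is strongly recurrent.
   Context: $X$ is a countably infinite set and $P=(p(x,y))_{x,y\in X}$ is an irreducible stochastic matrix on $X$ (for all $x,y$ there is $k$ with $p^{(k)}(x,y)>0$, where $p^{(k)}$ denotes $k$-step transition probabilities). For each $x\in X$, $\mu(x)=(\mu_k(x))_{k\ge 1}$ is a probability distribution on $\{1,2,3,\dots\}$ with finite mean $m(x)=\sum_{k\ge1} k\mu_k(x)$ (so every particle has at least one offspring). The branching Markov chain (BMC) $(X,P,\mu)$ is the following discrete-time particle system. At time $0$ there is one particle at a starting position. At each time step, each particle, located at $y$ say, is replaced by $k$ offspring particles with probability $\mu_k(y)$, and each offspring then independently moves to $z$ with probability $p(y,z)$; all branchings and movements are independent of the other particles and of the past. Let $\eta(n)$ be the total number of particles at time $n$, $x_i(n)$ the position of the $i$-th particle at time $n$ ($1\le i\le \eta(n)$), and $\mathbb{P}_x$ the law of the process started with one particle at $x$. Define $$\alpha(x):=\mathbb{P}_x\Big(\sum_{n=1}^\infty\sum_{i=1}^{\eta(n)}\mathbf 1\{x_i(n)=x\}=\infty\Big).$$ The BMC is strongly recurrent if $\alpha(x)=1$ for all $x\in X$. *)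

(* Defs.v *)
From mathcomp Require Import all_boot all_order all_algebra.
From mathcomp Require Import all_classical all_reals all_analysis.

Set Implicit Arguments.
Unset Strict Implicit.
Unset Printing Implicit Defensive.

Import Order.TTheory GRing.Theory Num.Theory.

Local Open Scope classical_set_scope.
Local Open Scope ring_scope.
Local Open Scope ereal_scope.

Definition stochastic (R : realType) (X : countType) (p : X -> X -> R) : Prop :=
  (forall x y, (0 <= p x y)%R) /\
  (forall x, \esum_(y in [set: X]) (p x y)%:E = 1).

Fixpoint kstep (R : realType) (X : countType) (p : X -> X -> R) (k : nat)
    (x y : X) : \bar R :=
  if k is k'.+1 then \esum_(z in [set: X]) ((p x z)%:E * kstep p k' z y)
  else ((x == y)%:R)%:E.

Definition irreducible (R : realType) (X : countType) (p : X -> X -> R) : Prop :=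
  forall x y, exists k, 0 < kstep p k x y.

(* [mu y k] is the probability that a particle at [y] has [k] offspring; the
   support lies in {1, 2, ...}, and the mean is finite at each site (not
   necessarily uniformly bounded). *)
Definition offspring_distribution (R : realType) (X : countType)
    (mu : X -> nat -> R) : Prop :=
  forall y, [/\ forall k, (0 <= mu y k)%R,
                mu y 0%N = 0%R,
                \sum_(1 <= k <oo) (mu y k)%:E = 1 &
                \sum_(1 <= k <oo) ((k%:R)%:E * (mu y k)%:E) < +oo].

(* [Y] is, under [Pr], a Markov chain started at [s0] with transition
   probabilities [Q].  The state space is countable, so measurability of [Y n]
   for the discrete sigma-algebra amounts to measurability of its fibres. *)
Definition markov_chain (R : realType) (d : measure_display)
    (T : measurableType d) (Pr : probability T R) (S : countType)
    (Q : S -> S -> R) (s0 : S) (Y : nat -> T -> S) : Prop :=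
  (forall n s, measurable [set w | Y n w = s]) /\
  (forall n (s : nat -> S),
     Pr [set w | forall i, (i <= n)%N -> Y i w = s i] =
     ((s 0%N == s0)%:R * \prod_(i < n) Q (s i) (s i.+1))%:E).

(* Probability that the offspring of a particle at [y], listed in order, end up
   at the positions in [l]: there are [size l] of them, each moving
   independently according to [p y]. *)
Definition litter_prob (R : realType) (X : countType) (p : X -> X -> R)
    (mu : X -> nat -> R) (y : X) (l : seq X) : R :=
  (mu y (size l) * \prod_(z <- l) p y z)%R.

(* A configuration is the list of the positions of the particles.  The next
   configuration is the concatenation of the litters of the successive
   particles, which are independent: below, the first particle [y] produces the
   first [i] entries of [t], and the remaining particles [s'] the others. *)
Fixpoint bmc_kernel (R : realType) (X : countType) (p : X -> X -> R)
    (mu : X -> nat -> R) (s t : seq X) : R :=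
  if s is y :: s' then
    (\sum_(i < (size t).+1)
       litter_prob p mu y (take i t) * bmc_kernel p mu s' (drop i t))%R
  else ((t == [::])%:R)%R.

(* [Pr x] is the law of the particle system started with one particle at [x];
   [Z n] lists the positions x_1(n), ..., x_eta(n)(n), with eta(n) =
   [size (Z n)]. *)
Definition branching_markov_chain (R : realType) (X : countType)
    (p : X -> X -> R) (mu : X -> nat -> R) (d : measure_display)
    (T : measurableType d) (Pr : X -> probability T R)
    (Z : nat -> T -> seq X) : Prop :=
  forall x, markov_chain (Pr x) (bmc_kernel p mu) [:: x] Z.

Definition alpha (R : realType) (X : countType) (d : measure_display)
    (T : measurableType d) (Pr : X -> probability T R)
    (Z : nat -> T -> seq X) (x : X) : \bar R :=
  Pr x [set w | \sum_(1 <= n <oo) \sum_(y <- Z n w) ((y == x)%:R)%:E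
                = +oo :> \bar R].

Definition strongly_recurrent (R : realType) (X : countType)
    (d : measure_display) (T : measurableType d) (Pr : X -> probability T R)
    (Z : nat -> T -> seq X) : Prop :=
  forall x, alpha Pr Z x = 1.

(* [Y] is the Markov chain, [Pr x] its law when started at [x]; the set [C] is
   required to be hit infinitely often from every starting point. *)
Definition recurrent_set (R : realType) (X : countType) (d : measure_display)
    (T : measurableType d) (Pr : X -> probability T R) (Y : nat -> T -> X)
    (C : set X) : Prop :=
  forall x, {ae Pr x, forall w, infinite_set [set n | C (Y n w)]}.

(* Main.v *)
Require Import Defs.
From mathcomp Require Import all_boot all_order all_algebra.
From mathcomp Require Import all_classical all_reals all_analysis.

Set Implicit Arguments.
Unset Strict Implicit.
Unset Printing Implicit Defensive.
Import Order.TTheory GRing.Theory Num.Theory.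

Local Open Scope classical_set_scope.
Local Open Scope ring_scope.
Local Open Scope ereal_scope.

(** Everything rests on one principle about a Markov chain [Y] on a countable
    set: if from every state of [B] the chain hits [A] with probability at
    least a fixed [1 - r > 0], then almost surely, visiting [B] infinitely often
    forces visiting [A] infinitely often ([le_visits_io]).  It plays the part of
    Levy's 0-1 law, but has an elementary proof: let [E] be the event that [B]
    is visited infinitely often and [A] never from time [N] on.  Stopping at the
    first visit to [B] after time [N + n] gives [Pr E <= r * Pr (F n)], where
    [F n] says that this visit exists and that [A] has been avoided between [N]
    and it.  The events [F n] decrease to [E], so [Pr E <= r * Pr E] and
    [Pr E = 0].

    The principle is applied to the chain of configurations, whose states are
    lists of positions.

    - From any configuration containing [x], the site [a] is reached with a
      probability bounded below: the single particle at [x] already does so by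
      irreducibility ([avoid_occupied_lt1]), and further particles only help
      ([avoid_occupied_mem]).  Hence the particle system started at [x] visits
      [a] infinitely often with probability at least [alpha x], which is at
      least [c] when [x] lies in [C].
    - Every particle has at least one child, so a configuration never becomes
      empty, and the first particle of the configuration (the first child of
      the first child of ...) performs the chain [(X, P)].  As [C] is recurrent
      for [P], this distinguished particle is in [C] infinitely often
      ([avoid_headed_le]).
    - From a configuration whose first particle is at [y] in [C], the site [x]
      is reached with probability at least [c], by the first point.  Hence [x]
      is visited infinitely often almost surely.

    Hitting probabilities are needed from every configuration, while the process
    is only given for one initial particle; they are therefore defined by
    first-step recursion ([avoid]) and related to the process through the Markov
    property ([prob_trajectory_misses]). *)

(** * Sums of nonnegative extended reals *)

Section EsumComplements.
Variable R : realType.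

Lemma esumZl (T : choiceType) (c : \bar R) (I : set T) (a : T -> \bar R) :
    c \is a fin_num -> 0 <= c -> (forall i, 0 <= a i) ->
  \esum_(i in I) (c * a i) = c * \esum_(i in I) a i.
Proof.
move=> + + a0; case: c => // c _ c0; rewrite lee_fin in c0.
rewrite /esum -ereal_supZl//; last first.
  by apply/set0P; exists 0; exists set0; [exact: fsets_set0|rewrite fsbig_set0].
congr ereal_sup; apply/seteqP; split.
  move=> _ [F [finF FI] <-]; exists (\sum_(x \in F) a x); first by exists F.
  by rewrite ge0_mule_fsumr.
by move=> _ [_ [F [finF FI] <-] <-]; exists F => //; rewrite ge0_mule_fsumr.
Qed.

Lemma contraction_eq0 (x : \bar R) (r : R) :
  x \is a fin_num -> 0 <= x -> (r < 1)%R -> x <= r%:E * x -> x = 0.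
Proof.
case: x => // x _; rewrite -EFinM !lee_fin => x0 r1 xr; congr (_%:E).
apply/eqP; rewrite eq_le x0 andbT -(pmulr_rle0 _ (_ : 0 < 1 - r)%R) ?subr_gt0//.
by rewrite mulrBl mul1r subr_le0.
Qed.

Lemma esum_exchange (T1 T2 : choiceType) (a : T1 -> T2 -> \bar R) :
    (forall i j, 0 <= a i j) ->
  \esum_(i in [set: T1]) \esum_(j in [set: T2]) a i j =
  \esum_(j in [set: T2]) \esum_(i in [set: T1]) a i j.
Proof.
move=> a0; rewrite !esum_esum//.
rewrite (reindex_esum ([set: T2] `*`` fun=> [set: T1]) _
  (fun x => (x.2, x.1)))//.
split=> //=; first by move=> [i j] [i' j'] _ _ /= [-> ->].
by move=> [i j] _; exists (j, i).
Qed.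

Lemma esum_seq (X : choiceType) (F : seq X -> \bar R) : (forall l, 0 <= F l) ->
  \esum_(l in [set: seq X]) F l =
  F [::] + \esum_(z in [set: X]) \esum_(l in [set: seq X]) F (z :: l).
Proof.
move=> F0; rewrite (esumID [set [::]])// !setTI esum_set1//; congr (_ + _).
rewrite esum_esum//.
rewrite (reindex_esum ([set: X] `*`` fun=> [set: seq X]) _
  (fun x => x.1 :: x.2))//.
split=> //=; first by move=> [i j] [i' j'] _ _ /= [-> ->].
by move=> [|z l] //= _; exists (z, l).
Qed.

End EsumComplements.

(** * Avoidance probabilities and visits of a chain *)

Section Chain.
Variables (R : realType) (S : countType).

(** The probability that the chain with kernel [Q] started at [s] stays out of
    [A] at times [0, ..., k], computed by conditioning on the first step, so
    that no process started at [s] is required. *)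
Fixpoint avoid (Q : S -> S -> R) (A : set S) (k : nat) (s : S) : \bar R :=
  if s \in A then 0
  else if k is k'.+1 then \esum_(t in [set: S]) ((Q s t)%:E * avoid Q A k' t)
  else 1.

Lemma avoid_ge0 Q A k s : (forall s t, (0 <= Q s t)%R) -> 0 <= avoid Q A k s.
Proof.
move=> Q0; elim: k s => [|k IH] s /=; case: ifP => // _.
by apply: esum_ge0 => t _; rewrite mule_ge0 ?lee_fin.
Qed.

Definition visits_io (T : Type) (Y : nat -> T -> S) (A : set S) : set T :=
  [set w | forall N, exists2 n, (N <= n)%N & A (Y n w)].

Definition misses (T : Type) (Y : nat -> T -> S) (A : set S) (N : nat) : set T :=
  [set w | forall n, (N <= n)%N -> ~ A (Y n w)].

Definition misses_until (T : Type) (Y : nat -> T -> S) (A : set S) (N k : nat)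
    : set T :=
  [set w | forall n, (N <= n < N + k.+1)%N -> ~ A (Y n w)].

Definition trajectory (T : Type) (Y : nat -> T -> S) (n : nat) (w : T) : seq S :=
  mkseq (fun i => Y i w) n.

Arguments trajectory : simpl never.

Lemma trajectoryS (T : Type) (Y : nat -> T -> S) n w :
  trajectory Y n.+1 w = rcons (trajectory Y n w) (Y n w).
Proof. by rewrite /trajectory mkseqS. Qed.

Lemma visits_ioE (T : Type) (Y : nat -> T -> S) (A : set S) :
  visits_io Y A = ~` \bigcup_N misses Y A N.
Proof.
apply/seteqP; split => w.
  by move=> io [N _] /= mi; have [n Nn An] := io N; exact: (mi n).
move=> nm N; apply: contrapT => nN; apply: nm; exists N => // n Nn An.
by apply: nN; exists n.
Qed.

End Chain.

Section Substochastic.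
Variables (R : realType) (S : countType) (Q : S -> S -> R).
Hypothesis Q0 : forall s t, (0 <= Q s t)%R.
Hypothesis Q1 : forall s, \esum_(t in [set: S]) (Q s t)%:E <= 1.

Lemma avoid_le1 A k s : avoid Q A k s <= 1.
Proof.
elim: k s => [|k IH] s /=; case: ifP => // _.
apply: le_trans (Q1 s); apply: le_esum => t _.
by rewrite -[leRHS]mule1; apply: lee_wpmul2l; rewrite ?lee_fin.
Qed.

Lemma avoid_fin_num A k s : avoid Q A k s \is a fin_num.
Proof.
rewrite ge0_fin_numE; last exact: avoid_ge0.
exact: le_lt_trans (avoid_le1 A k s) (ltry _).
Qed.

End Substochastic.

(** * The Markov property *)

Section MarkovChain.
Variables (R : realType) (d : measure_display) (T : measurableType d).
Variable Pr : probability T R.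

Lemma probability_eq1 (E : set T) :
  measurable E -> Pr.-negligible (~` E) -> Pr E = 1.
Proof.
move=> mE /(measure_negligible (measurableC mE)) E0.
have := probability_setC Pr (measurableC mE); rewrite setCK => ->.
by move: E0; rewrite /= => ->; rewrite sube0.
Qed.

Section Fibres.
Variables (I : countType) (f : T -> I).
Hypothesis mf : forall i, measurable [set w | f w = i].

Lemma measurable_fibres (D : set I) : measurable [set w | D (f w)].
Proof.
rewrite (_ : [set w | _] =
    \bigcup_(i : I) (if i \in D then [set w | f w = i] else set0)).
  by apply: countable_bigcupT_measurable => // i; case: ifP.
apply/seteqP; split => w /=.
  by move=> Dw; exists (f w) => //; rewrite mem_set.
by move=> [i _]; case: ifPn => // /set_mem Di ->.
Qed.

Lemma probability_fibres (E : set T) : measurable E ->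
  Pr E = \esum_(i in [set: I]) Pr (E `&` [set w | f w = i]).
Proof.
move=> mE.
pose F n :=
  if unpickle n is Some i then E `&` [set w : T | f w = (i : I)] else set0.
have mF n : measurable (F n).
  by rewrite /F; case: unpickle => // i; exact: measurableI.
have {1}-> : E = \bigcup_(n in [set n | exists i : I, n = pickle i]) F n.
  apply/seteqP; split => w.
    by move=> Ew; exists (pickle (f w)); [exists (f w)|rewrite /F pickleK].
  by move=> [_ [i ->]]; rewrite /F pickleK => -[].
rewrite measure_bigcup//; last first.
  move=> m n [i ->] [j ->]; rewrite /F !pickleK => -[w [[/= _ wi] [_ wj]]].
  by rewrite -wi -wj.
rewrite nneseries_esum//.
rewrite (_ : [set x | _] = range (@pickle I)); last first.
  apply/seteqP; split => n /=.
    by move=> /set_mem [i ->]; exists i.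
  by move=> [i _ <-]; apply/mem_set; exists i.
rewrite esum_image; last by move=> i j _ _ /(pcan_inj pickleK).
by apply: eq_esum => i _; rewrite /F pickleK.
Qed.

End Fibres.

Variables (S : countType) (Q : S -> S -> R) (s0 : S) (Y : nat -> T -> S).
Hypothesis Q0 : forall s t, (0 <= Q s t)%R.
Hypothesis Ymarkov : markov_chain Pr Q s0 Y.

Let mY n s : measurable [set w | Y n w = s].
Proof. exact: Ymarkov.1. Qed.

Lemma measurable_state n A : measurable [set w | A (Y n w)].
Proof. exact: measurable_fibres. Qed.

Lemma measurable_trajectory n (D : set (seq S)) :
  measurable [set w | D (trajectory Y n w)].
Proof.
apply: measurable_fibres => l; elim/last_ind: l n => [|l s IH] [|n].
- by rewrite (_ : [set w | _] = setT)//; apply/seteqP; split => w.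
- by rewrite (_ : [set w | _] = set0)//; apply/seteqP; split.
- rewrite (_ : [set w | _] = set0)//; apply/seteqP; split => w //=.
  by move=> /(congr1 size); rewrite size_rcons.
- rewrite (_ : [set w | _] =
      [set w | trajectory Y n w = l] `&` [set w | Y n w = s]).
    exact: measurableI.
  apply/seteqP; split => w /=; rewrite trajectoryS; last by move=> [-> ->].
  by move=> /rcons_inj[].
Qed.

Lemma measurable_misses_until A N k : measurable (misses_until Y A N k).
Proof.
rewrite (_ : misses_until _ _ _ _ =
   \bigcap_(n in [set n | (N <= n < N + k.+1)%N]) [set w | (~` A) (Y n w)]).
  by apply: bigcap_measurableType => n _; exact: measurable_state.
by apply/seteqP; split => w mi n; exact: mi.
Qed.

Lemma measurable_misses A N : measurable (misses Y A N).
Proof.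
rewrite (_ : misses _ _ _ =
   \bigcap_(n in [set n | (N <= n)%N]) [set w | (~` A) (Y n w)]).
  by apply: bigcap_measurableType => n _; exact: measurable_state.
by apply/seteqP; split => w mi n; exact: mi.
Qed.

Lemma measurable_visits_io A : measurable (visits_io Y A).
Proof.
rewrite visits_ioE; apply: measurableC; apply: bigcupT_measurable => N.
exact: measurable_misses.
Qed.

Lemma prob_trajectory l s t :
  Pr [set w | trajectory Y (size l).+2 w = rcons (rcons l s) t] =
  Pr [set w | trajectory Y (size l).+1 w = rcons l s] * (Q s t)%:E.
Proof.
have E n (u : nat -> S) : [set w | forall i, (i <= n)%N -> Y i w = u i] =
    [set w | trajectory Y n.+1 w = mkseq u n.+1].
  apply/seteqP; split => w /= H.
    by apply/eq_in_map => i; rewrite mem_iota => /andP[_ lin]; exact: H.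
  move=> i lein; move/(congr1 (nth s0 ^~ i)): H.
  by rewrite !nth_mkseq.
pose u i := nth s0 (rcons (rcons l s) t) i.
have u1 : mkseq u (size l).+2 = rcons (rcons l s) t.
  by rewrite -[in RHS](mkseq_nth s0 (rcons _ _)) !size_rcons.
have u2 : mkseq u (size l).+1 = rcons l s.
  by move: u1; rewrite mkseqS => /rcons_inj[].
rewrite -u1 -u2 -!E !Ymarkov.2 big_ord_recr/= mulrA EFinM.
have -> : u (size l) = s by rewrite /u !nth_rcons size_rcons ltnSn ltnn eqxx.
by have -> : u (size l).+1 = t by rewrite /u nth_rcons size_rcons ltnn eqxx.
Qed.

(** The Markov property at time [size l]: given the past, the probability of
    staying out of [A] for [k] more steps only depends on the present state.
    Here [rcons l s] is the trajectory up to that time, and the induction on [k]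
    conditions on the next state. *)
Lemma prob_trajectory_misses A k l s :
  Pr ([set w | trajectory Y (size l).+1 w = rcons l s]
        `&` misses_until Y A (size l) k) =
  Pr [set w | trajectory Y (size l).+1 w = rcons l s] * avoid Q A k s.
Proof.
have last_state w : trajectory Y (size l).+1 w = rcons l s -> Y (size l) w = s.
  by rewrite trajectoryS => /rcons_inj[].
have inA k' : s \in A ->
  [set w | trajectory Y (size l).+1 w = rcons l s]
    `&` misses_until Y A (size l) k' = set0.
  move=> sA; apply/seteqP; split => w //= [/last_state ws mi].
  apply: (mi (size l)); first by rewrite leqnn addnS ltnS leq_addr.
  by rewrite ws; exact: set_mem.
elim: k l s last_state inA => [|k IH] l s last_state inA /=; case: ifPn => sA;
  try by rewrite inA// measure0 mule0.
  rewrite mule1; congr (Pr _).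
  apply/seteqP; split => w /= [] // ws; split => // n.
  rewrite addn1 ltnS => /anti_leq <-; rewrite last_state//.
  by move=> /mem_set; exact/negP.
rewrite (probability_fibres (mY (size l).+1)); last first.
  by apply: measurableI; [exact: (measurable_trajectory _ [set rcons l s])|
    exact: measurable_misses_until].
rewrite -esumZl//; last 2 first.
- by apply: fin_num_measure; exact: (measurable_trajectory _ [set rcons l s]).
- by move=> t; rewrite mule_ge0 ?lee_fin ?avoid_ge0.
apply: eq_esum => t _.
rewrite muleA -prob_trajectory.
have := IH (rcons l s) t; rewrite size_rcons => <-; last 2 first.
- by move=> w; rewrite trajectoryS => /rcons_inj[].
- move=> k' tA; apply/seteqP; split => w //= [+ mi].
  rewrite trajectoryS => /rcons_inj[_ wt].
  apply: (mi (size l).+1); first by rewrite leqnn addnS ltnS leq_addr.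
  by rewrite wt; exact: set_mem.
congr (Pr _); apply/seteqP; split => w /=.
  move=> [[ws mi] wt]; split; first by rewrite trajectoryS ws wt.
  by move=> n /andP[ln nk]; apply: mi; rewrite (ltnW ln) addnS -addSn.
rewrite trajectoryS => -[/rcons_inj[ws wt] mi]; split => //; split => // n.
rewrite leq_eqVlt => /andP[/orP[/eqP <- _|ln]].
  by rewrite last_state// => /mem_set; exact/negP.
by rewrite addnS -addSn => nk; apply: mi; rewrite ln.
Qed.

Lemma misses_sub A N M k : (N <= M)%N -> misses Y A N `<=` misses_until Y A M k.
Proof. by move=> NM w mi n /andP[Mn _]; apply: mi; exact: leq_trans Mn. Qed.

(** The number of steps [k] may depend on the state reached at time [m] without
    being bounded over these states, which is why the conclusion is about
    missing [A] forever.  The event [D] stands for an arbitrary event of the past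
    of time [m]; it is cut into single trajectories, countably many. *)
Lemma prob_misses_le A r m (D : set (seq S)) : (0 <= r)%R ->
  (forall w, D (trajectory Y m.+1 w) -> exists k, avoid Q A k (Y m w) <= r%:E) ->
  Pr ([set w | D (trajectory Y m.+1 w)] `&` misses Y A m) <=
  r%:E * Pr [set w | D (trajectory Y m.+1 w)].
Proof.
move=> r0 DB; set E := [set w | D (trajectory Y m.+1 w)].
have mt l : measurable [set w | trajectory Y m.+1 w = l].
  exact: (measurable_trajectory _ [set l]).
have mE : measurable E by exact: measurable_trajectory.
have mM : measurable (misses Y A m) by exact: measurable_misses.
rewrite (probability_fibres mt)//; last exact: measurableI.
rewrite [in leRHS](probability_fibres mt)// -esumZl//; apply: le_esum => l _.
have [E0|/set0P[w [Dw wl]]] :=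
  eqVneq (E `&` [set w | trajectory Y m.+1 w = l]) set0.
  by rewrite setIAC E0 set0I measure0 mule0.
have {}E0 : E `&` [set w | trajectory Y m.+1 w = l] =
    [set w | trajectory Y m.+1 w = l].
  by apply/seteqP; split => v /= [] // vl; split => //; rewrite /E /= vl -wl.
rewrite setIAC E0; have [k wk] := DB _ Dw.
have {wl}-> : l = rcons (trajectory Y m w) (Y m w) by rewrite -trajectoryS.
have sm : m = size (trajectory Y m w) by rewrite size_mkseq.
rewrite muleC; apply: (@le_trans _ _
  (Pr [set v | trajectory Y (size (trajectory Y m w)).+1 v =
               rcons (trajectory Y m w) (Y m w)] * avoid Q A k (Y m w))); last first.
  by rewrite -sm; exact: lee_wpmul2l.
rewrite -prob_trajectory_misses -sm; apply: le_measure; rewrite ?inE.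
- by apply: measurableI => //; exact: mt.
- by apply: measurableI; [exact: mt|exact: measurable_misses_until].
- by apply: setIS; exact: misses_sub.
Qed.

(** * Transfer of infinitely many visits *)

(** After the first visit to [B] past a late time, [A] is missed forever with
    conditional probability at most [r]; yet the event that such a visit occurs
    with [A] avoided so far is barely more likely than the limit event. *)
Lemma visits_io_misses_null A B r : (0 <= r < 1)%R ->
  (forall s, B s -> exists k, avoid Q A k s <= r%:E) ->
  Pr (visits_io Y B `\` visits_io Y A) = 0.
Proof.
move=> /andP[r0 r1] Bk.
have mM N : measurable (misses Y A N) by exact: measurable_misses.
have mB : measurable (visits_io Y B) by exact: measurable_visits_io.
have misses_null N : Pr (visits_io Y B `&` misses Y A N) = 0.
  (* [G n m]: the first visit to [B] from time [N + n] on occurs at time [m],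
     and [A] is avoided between [N] and [m] *)
  pose G n m := [set w | [/\ (N + n <= m)%N, B (Y m w),
    (forall i, (N + n <= i < m)%N -> ~ B (Y i w)) &
    (forall i, (N <= i <= m)%N -> ~ A (Y i w))]].
  pose F n := \bigcup_m G n m.
  have GE n m : G n m =
      [set w | (trajectory Y m.+1 @` G n m) (trajectory Y m.+1 w)].
    apply/seteqP; split => w; first by move=> Gw; exists w.
    move=> [v [nm Bv nB nA] /eq_in_map vw].
    have {}vw i : (i <= m)%N -> Y i w = Y i v.
      by move=> im; rewrite vw// mem_iota.
    split=> //; first by rewrite vw.
      by move=> i /andP[ni im]; rewrite vw ?(ltnW im)//; apply: nB; rewrite ni.
    by move=> i /andP[ni im]; rewrite vw//; apply: nA; rewrite ni.
  have mG n m : measurable (G n m) by rewrite GE; exact: measurable_trajectory.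
  have mF n : measurable (F n) by exact: bigcupT_measurable.
  have tG n : trivIset setT (G n).
    move=> i j _ _ [w [[ni Bi nBi _] [nj Bj nBj _]]].
    case: (ltngtP i j) => // ij; exfalso.
      by apply: (nBj i) => //; rewrite ni.
    by apply: (nBi j) => //; rewrite nj.
  have F_contract n : Pr (F n `&` misses Y A N) <= r%:E * Pr (F n).
    rewrite /F setI_bigcupl !measure_bigcup//; last 2 first.
    - by move=> m _; exact: measurableI.
    - move=> i j _ _ [w [[Gi _] [Gj _]]].
      by apply: (tG n) => //; exists w.
    rewrite -nneseriesZl//; apply: lee_nneseries => // m _.
    apply: (@le_trans _ _ (Pr (G n m `&` misses Y A m))).
      have [Nnm|nm] := leqP (N + n) m; last first.
        rewrite (_ : G n m = set0) ?set0I ?measure0//.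
        by apply/seteqP; split => w // []; rewrite leqNgt nm.
      apply: le_measure; rewrite ?inE; [exact: measurableI..|].
      apply: setIS => w mi i mi'; apply: mi; apply: leq_trans mi'.
      by apply: leq_trans Nnm; rewrite leq_addr.
    rewrite GE; apply: prob_misses_le => // w [v [_ Bv _ _]].
    move=> /(congr1 (last (Y m w))); rewrite !trajectoryS !last_rcons => <-.
    exact: Bk.
  have firstF n m w : (N + n <= m)%N -> B (Y m w) ->
      (forall i, (N <= i <= m)%N -> ~ A (Y i w)) -> F n w.
    move=> nm Bm nA.
    have ex : exists m, (N + n <= m)%N && `[< B (Y m w) >].
      by exists m; rewrite nm; exact/asboolP.
    case: (ex_minnP ex) => m' /andP[nm' /asboolP Bm'] minm'; exists m' => //.
    split => // i /andP[ni im'].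
      move=> Bi; suff : (m' <= i)%N by rewrite leqNgt im'.
      by apply: minm'; rewrite ni; exact/asboolP.
    apply: nA; rewrite ni/= (leq_trans im')//.
    by apply: minm'; rewrite nm; exact/asboolP.
  have subF n : visits_io Y B `&` misses Y A N `<=` F n `&` misses Y A N.
    move=> w [ioB mi]; split => //; have [m nm Bm] := ioB (N + n)%N.
    by apply: (firstF n m) => // i /andP[Ni _]; exact: mi.
  have capF : \bigcap_n F n = visits_io Y B `&` misses Y A N.
    apply/seteqP; split => w; last by move=> Ew n _; have [] := subF n _ Ew.
    move=> Fw; split => [M|i Ni].
      have [m _ [Mm Bm _ _]] := Fw M I; exists m => //.
      by apply: leq_trans Mm; rewrite leq_addl.
    have [m _ [im _ _ nA]] := Fw i I; apply: nA; rewrite Ni/=.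
    by apply: leq_trans im; rewrite leq_addl.
  have cvgF : Pr \o F @ \oo --> Pr (visits_io Y B `&` misses Y A N).
    rewrite -capF; apply: nonincreasing_cvg_mu => //.
    - by rewrite -ge0_fin_numE// fin_num_measure.
    - exact: bigcapT_measurable.
    - move=> n n' nn'; apply/subsetPset => w [m _ [n'm Bm nB nA]].
      by apply: firstF Bm nA; apply: leq_trans n'm; rewrite leq_add2l.
  have le_r : Pr (visits_io Y B `&` misses Y A N) <=
      r%:E * Pr (visits_io Y B `&` misses Y A N).
    apply: (cvge_to_ge (cvgeZl _ cvgF)) => //; apply: nearW => n /=.
    apply: le_trans (F_contract n); apply: le_measure; rewrite ?inE//;
      exact: measurableI.
  apply: contraction_eq0 r1 le_r => //.
  by apply: fin_num_measure; exact: measurableI.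
rewrite (visits_ioE Y A) setDE setCK setI_bigcupr; apply/negligibleP.
  by apply: bigcupT_measurable => N; exact: measurableI.
by apply: negligible_bigcup => N; apply/negligibleP;
  [exact: measurableI|exact: misses_null].
Qed.

Lemma le_visits_io A B r : (0 <= r < 1)%R ->
  (forall s, B s -> exists k, avoid Q A k s <= r%:E) ->
  Pr (visits_io Y B) <= Pr (visits_io Y A).
Proof.
move=> r01 Bk.
have mA : measurable (visits_io Y A) by exact: measurable_visits_io.
have mB : measurable (visits_io Y B) by exact: measurable_visits_io.
rewrite (measureDI Pr mB mA) [X in X + _](_ : _ = 0); last first.
  exact: visits_io_misses_null r01 Bk.
by rewrite add0e; apply: le_measure; rewrite ?inE//; exact: measurableI.
Qed.

Lemma prob_start : Pr [set w | trajectory Y 1 w = [:: s0]] = 1.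
Proof.
rewrite (_ : [set w | _] = [set w | forall i, (i <= 0)%N -> Y i w = s0]).
  by rewrite (Ymarkov.2 0%N (fun=> s0)) big_ord0 eqxx mulr1.
apply/seteqP; split => w; first by move=> [w0] i; rewrite leqn0 => /eqP ->.
by move=> w0; rewrite /= /trajectory /mkseq /= w0.
Qed.

Lemma prob_misses_until A k : Pr (misses_until Y A 0 k) = avoid Q A k s0.
Proof.
pose E := [set w | trajectory Y 1 w = [:: s0]].
have mE : measurable E by exact: (measurable_trajectory _ [set [:: s0]]).
have mM : measurable (misses_until Y A 0 k) by exact: measurable_misses_until.
have PE : Pr E = 1 := prob_start.
have := prob_trajectory_misses A k [::] s0; rewrite /= -/E PE mul1e => <-.
rewrite (measureDI Pr mM mE) [X in X + _](_ : _ = 0) ?add0e; last first.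
  apply/eqP; rewrite -measure_le0.
  rewrite -[leRHS](_ : Pr (~` E) = 0); last first.
    by rewrite probability_setC// PE subee.
  apply: le_measure; rewrite ?inE; [exact: measurableD|exact: measurableC|].
  by move=> w [].
by rewrite setIC.
Qed.

(** Visiting [A] infinitely often entails hitting it, so the avoidance
    probabilities of the initial state decrease to at most [1 - c]; the slack
    [1 - c < r] turns the limit into a finite number of steps. *)
Lemma avoid_le_visits_io A c r : (1 - c < r)%R -> c%:E <= Pr (visits_io Y A) ->
  exists k, avoid Q A k s0 <= r%:E.
Proof.
move=> cr cA.
have cvg : Pr \o misses_until Y A 0 @ \oo --> Pr (misses Y A 0).
  have -> : misses Y A 0 = \bigcap_k misses_until Y A 0 k.
    apply/seteqP; split => w mi; first by move=> k _; exact: misses_sub mi.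
    by move=> n _; apply: (mi n I); rewrite add0n ltnS leqnn.
  apply: nonincreasing_cvg_mu => //.
  - rewrite -ge0_fin_numE// fin_num_measure//.
    exact: measurable_misses_until.
  - by move=> k; exact: measurable_misses_until.
  - by apply: bigcapT_measurable => k; exact: measurable_misses_until.
  - move=> k k' kk'; apply/subsetPset => w mi n /andP[_ nk]; apply: mi.
    by rewrite (leq_trans nk)// !add0n ltnS.
have lt : Pr (misses Y A 0) < r%:E.
  apply: (@le_lt_trans _ _ (1 - c)%:E); last by rewrite lte_fin.
  apply: (@le_trans _ _ (Pr (~` visits_io Y A))).
    apply: le_measure; rewrite ?inE; [exact: measurable_misses| |].
      by apply: measurableC; exact: measurable_visits_io.
    by rewrite visits_ioE setCK; exact: bigcup_sup.
  rewrite probability_setC; last exact: measurable_visits_io.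
  by rewrite EFinB leeB.
apply: contrapT => nk; move: lt; rewrite ltNge => /negP; apply.
apply: (cvge_to_ge cvg); apply: nearW => k /=; rewrite prob_misses_until.
by rewrite leNgt; apply/negP => /ltW rk; apply: nk; exists k.
Qed.

(** A closed set containing the initial state is never left, outside of the null
    event that some transition of probability zero occurs. *)
Lemma visits_io_closed A : A s0 ->
  (forall s t, A s -> ~ A t -> Q s t = 0%R) -> Pr (visits_io Y A) = 1.
Proof.
move=> As0 A_closed.
have mA n : measurable [set w | A (Y n w)] by exact: measurable_state.
have exit_null n : Pr.-negligible [set w | ~ A (Y n w)].
  elim: n => [|n IH].
    apply/negligibleP; first exact: measurableC (mA 0%N).
    suff A1 : Pr [set w | A (Y 0%N w)] = 1.
      by have := probability_setC Pr (mA 0%N); rewrite A1 subee.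
    apply/eqP; rewrite eq_le probability_le1//= -prob_start.
    apply: le_measure; rewrite ?inE//.
      exact: (measurable_trajectory _ [set [:: s0]]).
    by move=> w [/= ->].
  pose E := [set w | A (Y n w) /\ ~ A (Y n.+1 w)].
  have mE : measurable E by exact: measurableI (mA n) (measurableC (mA n.+1)).
  apply: (@negligibleS _ _ _ _ ([set w | ~ A (Y n w)] `|` E)).
    by move=> w nA /=; have [An|] := pselect (A (Y n w)); [right|left].
  suff E0 : Pr E = 0 by apply: negligibleU => //; exact/negligibleP.
  rewrite (probability_fibres (fun l => measurable_trajectory n.+2 [set l]))//.
  apply: esum1 => l _.
  have [->|/set0P[w [[An An1] wl]]] :=
    eqVneq (E `&` [set w | [set l] (trajectory Y n.+2 w)]) set0.
    by rewrite measure0.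
  apply/eqP; rewrite -measure_le0.
  have := prob_trajectory (trajectory Y n w) (Y n w) (Y n.+1 w).
  rewrite (A_closed _ _ An An1) mule0 => <-.
  have -> : size (trajectory Y n w) = n by rewrite size_mkseq.
  apply: le_measure; rewrite ?inE.
  - by apply: measurableI => //; exact: (measurable_trajectory _ [set l]).
  - exact: (measurable_trajectory _ [set rcons _ _]).
  - by move=> v [_ /= ->]; rewrite -wl !trajectoryS.
apply: probability_eq1; first exact: measurable_visits_io.
apply: negligibleS (negligible_bigcup exit_null) => w.
rewrite visits_ioE setCK => -[N _ mi]; exists N => //; exact: mi.
Qed.

End MarkovChain.

(** * Litters and the configuration kernel *)

Section Branching.
Variables (R : realType) (X : countType) (p : X -> X -> R) (mu : X -> nat -> R).
Hypothesis hp : stochastic p.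
Hypothesis hmu : offspring_distribution mu.

Let p0 x y : (0 <= p x y)%R. Proof. exact: hp.1. Qed.
Let p1 x : \esum_(y in [set: X]) (p x y)%:E = 1. Proof. exact: hp.2. Qed.
Let mu0 y k : (0 <= mu y k)%R. Proof. by have [] := hmu y. Qed.

Let prod_ge0 y (l : seq X) : (0 <= \prod_(z <- l) p y z)%R.
Proof. by apply: prodr_ge0. Qed.

Lemma litter_ge0 y l : (0 <= litter_prob p mu y l)%R.
Proof. by rewrite mulr_ge0. Qed.

Lemma bmc_kernel_ge0 s t : (0 <= bmc_kernel p mu s t)%R.
Proof.
elim: s t => [|y s IH] t /=; first by case: eqP.
by apply: sumr_ge0 => i _; rewrite mulr_ge0// litter_ge0.
Qed.

Lemma esum_displacements y n :
  \esum_(l in [set: seq X])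
    (if size l == n then \prod_(z <- l) p y z else 0)%:E = 1.
Proof.
elim: n => [|n IH].
  rewrite esum_seq => [|l]; last by case: ifP => // _; rewrite lee_fin.
  by rewrite /= big_nil esum1 ?adde0// => z _; rewrite esum1.
rewrite esum_seq => [|l]; last by case: ifP => // _; rewrite lee_fin.
rewrite /= add0e -[RHS](p1 y); apply: eq_esum => z _.
rewrite -[RHS]mule1 -IH -esumZl ?lee_fin//; last first.
  by move=> l; case: ifP => // _; rewrite lee_fin.
by apply: eq_esum => l _; rewrite eqSS big_cons; case: ifP => _ //; rewrite mule0.
Qed.

(** The weight [f] of the litter size is kept arbitrary because both the
    offspring law and its shift by one occur: the latter is the law of the number
    of siblings of the first child. *)
Lemma esum_size_displacements (f : nat -> R) y : (forall n, (0 <= f n)%R) ->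
  \esum_(l in [set: seq X]) (f (size l) * \prod_(z <- l) p y z)%:E =
  \esum_(n in [set: nat]) (f n)%:E.
Proof.
move=> f0.
have -> : \esum_(n in [set: nat]) (f n)%:E = \esum_(n in [set: nat])
    \esum_(l in [set: seq X])
      ((f n)%:E * (if size l == n then \prod_(z <- l) p y z else 0)%:E).
  apply: eq_esum => n _; rewrite esumZl//; last 2 first.
    by rewrite lee_fin.
    by move=> l; case: ifP => // _; rewrite lee_fin.
  by rewrite esum_displacements mule1.
rewrite esum_exchange; last first.
  by move=> n l; rewrite mule_ge0 ?lee_fin//; case: ifP.
apply: eq_esum => l _.
rewrite (esumID [set size l])//; last first.
  by move=> n _; rewrite mule_ge0 ?lee_fin//; case: ifP.
rewrite !setTI esum_set1 ?eqxx; last by rewrite mule_ge0 ?lee_fin//; case: ifP.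
rewrite esum1 ?adde0// => n /= /eqP; rewrite eq_sym => /negbTE ->.
by rewrite mule0.
Qed.

Lemma esum_offspringS y : \esum_(n in [set: nat]) (mu y n.+1)%:E = 1.
Proof.
have [_ _ <- _] := hmu y.
rewrite -nneseries_esumT; last by move=> n; rewrite lee_fin.
rewrite -(nneseries_addn (f := fun k => (mu y k)%:E)); last first.
  by move=> n; rewrite lee_fin.
by apply: eq_eseriesr => n _; rewrite addn1.
Qed.

Lemma esum_offspring y : \esum_(n in [set: nat]) (mu y n)%:E = 1.
Proof.
have [_ m0 m1 _] := hmu y.
rewrite -nneseries_esumT; last by move=> n; rewrite lee_fin.
by rewrite nneseries_recl// ?m0 ?add0e// => n _; rewrite lee_fin.
Qed.

Lemma esum_litter y : \esum_(l in [set: seq X]) (litter_prob p mu y l)%:E = 1.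
Proof. by rewrite esum_size_displacements// esum_offspring. Qed.

(** Independence of the litters of different particles: the kernel convolves the
    litter of [y] with the descendants of the other particles.  A pair of lists
    is the same thing as their concatenation together with the cut point, which
    is the summation index in the definition of the kernel. *)
Lemma esum_bmc_kernel_cons y s (F : seq X -> \bar R) : (forall t, 0 <= F t) ->
  \esum_(t in [set: seq X]) ((bmc_kernel p mu (y :: s) t)%:E * F t) =
  \esum_(l in [set: seq X]) ((litter_prob p mu y l)%:E *
    \esum_(t in [set: seq X]) ((bmc_kernel p mu s t)%:E * F (l ++ t))).
Proof.
move=> F0.
pose h (t : seq X) i := (litter_prob p mu y (take i t))%:E *
   ((bmc_kernel p mu s (drop i t))%:E * F t).
have h0 t i : 0 <= h t i.
  by rewrite !mule_ge0 ?lee_fin ?litter_ge0 ?bmc_kernel_ge0.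
have -> : \esum_(t in [set: seq X]) ((bmc_kernel p mu (y :: s) t)%:E * F t) =
    \esum_(t in [set: seq X]) \esum_(i in [set i | (i <= size t)%N]) h t i.
  apply: eq_esum => t _ /=.
  rewrite (_ : [set i | _] = `I_(size t).+1)// esum_fset// -fsbig_ord /=.
  rewrite -sumEFin ge0_sume_distrl; last first.
    by move=> i _; rewrite lee_fin mulr_ge0 ?litter_ge0 ?bmc_kernel_ge0.
  by apply: eq_bigr => i _; rewrite EFinM -muleA.
rewrite esum_esum//.
have -> : \esum_(l in [set: seq X]) ((litter_prob p mu y l)%:E *
    \esum_(t in [set: seq X]) ((bmc_kernel p mu s t)%:E * F (l ++ t))) =
  \esum_(l in [set: seq X]) \esum_(t in [set: seq X])
    ((litter_prob p mu y l)%:E * ((bmc_kernel p mu s t)%:E * F (l ++ t))).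
  apply: eq_esum => l _; rewrite esumZl ?lee_fin ?litter_ge0//.
  by move=> t; rewrite mule_ge0 ?lee_fin ?bmc_kernel_ge0.
rewrite esum_esum; last first.
  by move=> l t _ _; rewrite !mule_ge0 ?lee_fin ?litter_ge0 ?bmc_kernel_ge0.
rewrite (reindex_esum ([set: seq X] `*`` fun=> [set: seq X]) _
  (fun lt => (lt.1 ++ lt.2, size lt.1))); last first.
  split=> /=.
  - by move=> [l t] _ /=; split => //=; rewrite size_cat leq_addr.
  - move=> [l t] [l' t'] _ _ /= [e sl].
    by move/eqP: e; rewrite eqseq_cat// => /andP[/eqP -> /eqP ->].
  - move=> [t i] [_ /= it]; exists (take i t, drop i t) => //=.
    by rewrite cat_take_drop size_takel.
by apply: eq_esum => -[l t] _; rewrite /h /= take_size_cat// drop_size_cat.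
Qed.

Lemma esum_bmc_kernel s : \esum_(t in [set: seq X]) (bmc_kernel p mu s t)%:E = 1.
Proof.
have E s' : \esum_(t in [set: seq X]) (bmc_kernel p mu s' t)%:E =
   \esum_(t in [set: seq X]) ((bmc_kernel p mu s' t)%:E * 1).
  by apply: eq_esum => t _; rewrite mule1.
elim: s => [|y s IH].
  rewrite esum_seq => [|l]; last by rewrite lee_fin bmc_kernel_ge0.
  by rewrite /= esum1 ?adde0// => z _; rewrite esum1.
rewrite E esum_bmc_kernel_cons// -[RHS](esum_litter y); apply: eq_esum => l _.
by rewrite -E IH mule1.
Qed.

(** The first child exists since litters are never empty, and it moves according
    to [p y] whatever the number of its siblings. *)
Lemma esum_litter_head_le y (G : seq X -> \bar R) (g : X -> \bar R) :
    (forall l, 0 <= G l) -> (forall z, g z \is a fin_num) ->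
    (forall z l, G (z :: l) <= g z) ->
  \esum_(l in [set: seq X]) ((litter_prob p mu y l)%:E * G l) <=
  \esum_(z in [set: X]) ((p y z)%:E * g z).
Proof.
move=> G0 gfin Gg.
have g0 z : 0 <= g z by exact: le_trans (Gg z [::]).
rewrite esum_seq => [|l]; last by rewrite mule_ge0 ?lee_fin ?litter_ge0.
have [_ m0 _ _] := hmu y.
rewrite {1}/litter_prob /= m0 mul0r mul0e add0e; apply: le_esum => z _.
rewrite -[leRHS]mule1 -(esum_offspringS y).
rewrite -(esum_size_displacements y (f := fun n => mu y n.+1))//.
rewrite -esumZl ?mule_ge0 ?fin_numM ?lee_fin//; last first.
  by move=> l; rewrite lee_fin mulr_ge0.
apply: le_esum => l _; rewrite /litter_prob /= big_cons mulrCA EFinM.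
rewrite -!muleA; apply: lee_wpmul2l; first by rewrite lee_fin.
by rewrite muleC; apply: lee_wpmul2r; rewrite // lee_fin mulr_ge0.
Qed.

(** The first particle of a configuration is followed, generation after
    generation, by its first child, that is, by a chain with kernel [p]. *)
Lemma esum_bmc_kernel_head_le y s (G : seq X -> \bar R) (g : X -> \bar R) :
    (forall l, 0 <= G l) -> (forall z, g z \is a fin_num) ->
    (forall z l, G (z :: l) <= g z) ->
  \esum_(t in [set: seq X]) ((bmc_kernel p mu (y :: s) t)%:E * G t) <=
  \esum_(z in [set: X]) ((p y z)%:E * g z).
Proof.
move=> G0 gfin Gg; rewrite esum_bmc_kernel_cons//.
have g0 z : 0 <= g z by exact: le_trans (Gg z [::]).
apply: esum_litter_head_le => // [l|z l].
  by apply: esum_ge0 => t _; rewrite mule_ge0 ?lee_fin ?bmc_kernel_ge0.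
rewrite -[leRHS]mule1 -(esum_bmc_kernel s) -esumZl; [|exact: gfin|exact: g0|
  by move=> t; rewrite lee_fin bmc_kernel_ge0].
apply: le_esum => t _; rewrite muleC; apply: lee_wpmul2r; last exact: Gg.
by rewrite lee_fin bmc_kernel_ge0.
Qed.

(** * Avoidance probabilities of the particle system *)

Definition occupied (x : X) : set (seq X) := [set s | x \in s].

Lemma mem_occupied x s : (s \in occupied x) = (x \in s).
Proof. by apply/idP/idP => [/set_mem|?]; [|exact: mem_set]. Qed.

Definition headed (C : set X) : set (seq X) :=
  [set s | if s is y :: _ then C y else False].

(** The recursion defining the left-hand side is dominated step by step by that of
    the right-hand side, since the first particle moves by [p]. *)
Lemma avoid_headed_le C k y s :
  avoid (bmc_kernel p mu) (headed C) k (y :: s) <= avoid p C k y.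
Proof.
have p_le1 x : \esum_(z in [set: X]) (p x z)%:E <= 1 by rewrite p1.
have inC s' : (y :: s' \in headed C) = (y \in C).
  by apply/idP/idP => /set_mem H; exact: mem_set.
elim: k y s inC => [|k IH] y s inC /=; rewrite inC; case: ifP => // _.
apply: (@esum_bmc_kernel_head_le y s _ (avoid p C k)) => [l|z|z l].
- by apply: avoid_ge0; exact: bmc_kernel_ge0.
- exact: avoid_fin_num.
- by apply: IH => s'; apply/idP/idP => /set_mem H; exact: mem_set.
Qed.

Local Notation K := (bmc_kernel p mu).

Let K1 s : \esum_(t in [set: seq X]) (K s t)%:E <= 1.
Proof. by rewrite esum_bmc_kernel. Qed.

(** The particles present evolve independently: the expectation, one step later,
    of a multiplicative functional [W] of the configuration is again
    multiplicative.  The factor contributed by a particle at [y] is the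
    expectation [v y] of [W] over its litter. *)
Lemma esum_bmc_kernel_cat (W : seq X -> \bar R) : (forall s, W s \is a fin_num) ->
    (forall s, 0 <= W s <= 1) -> W [::] = 1 ->
    (forall s t, W (s ++ t) = W s * W t) ->
  let U s := \esum_(t in [set: seq X]) ((K s t)%:E * W t) in
  U [::] = 1 /\ forall s t, U (s ++ t) = U s * U t.
Proof.
move=> Wfin W01 W1 Wcat U.
have W0 s : 0 <= W s by have /andP[] := W01 s.
have U0 s : 0 <= U s.
  by apply: esum_ge0 => t _; rewrite mule_ge0 ?lee_fin ?bmc_kernel_ge0.
have Ufin s : U s \is a fin_num.
  rewrite ge0_fin_numE//; apply: le_lt_trans (ltry 1); apply: le_trans (K1 s).
  apply: le_esum => t _; rewrite -[leRHS]mule1; apply: lee_wpmul2l.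
    by rewrite lee_fin bmc_kernel_ge0.
  by have /andP[] := W01 t.
have Unil : U [::] = 1.
  rewrite /U esum_seq => [|l]; last by rewrite mule_ge0 ?lee_fin ?bmc_kernel_ge0.
  rewrite /= W1 mule1 esum1 ?adde0// => z _.
  by rewrite esum1// => l _; rewrite mul0e.
split=> //.
pose v y := \esum_(l in [set: seq X]) ((litter_prob p mu y l)%:E * W l).
have v0 y : 0 <= v y.
  by apply: esum_ge0 => l _; rewrite mule_ge0 ?lee_fin ?litter_ge0.
have Ucons y s : U (y :: s) = v y * U s.
  rewrite [LHS]esum_bmc_kernel_cons// [RHS]muleC -[RHS]esumZl//; last first.
    by move=> l; rewrite mule_ge0 ?lee_fin ?litter_ge0.
  apply: eq_esum => l _; rewrite [RHS]muleCA; congr (_ * _).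
  rewrite [RHS]muleC -esumZl//; last first.
    by move=> t; rewrite mule_ge0 ?lee_fin ?bmc_kernel_ge0.
  by apply: eq_esum => t _; rewrite Wcat muleCA.
by elim=> [|y s IH] t; rewrite ?Unil ?mul1e// cat_cons !Ucons IH muleA.
Qed.

Lemma avoid_occupied_multiplicative x k :
  avoid K (occupied x) k [::] = 1 /\
  forall s t, avoid K (occupied x) k (s ++ t) =
    avoid K (occupied x) k s * avoid K (occupied x) k t.
Proof.
elim: k => [|k [IH1 IH2]].
  split=> [|s t]; rewrite /= !mem_occupied//.
  rewrite mem_cat; case: (x \in s); case: (x \in t);
    by rewrite ?mul0e ?mule0 ?mule1.
have [] := @esum_bmc_kernel_cat (avoid K (occupied x) k) _ _ IH1 IH2.
- by move=> s; apply: avoid_fin_num => //; exact: bmc_kernel_ge0.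
- by move=> s; rewrite avoid_ge0 ?avoid_le1//; exact: bmc_kernel_ge0.
move=> U1 Ucat; split=> [|s t]; rewrite /= !mem_occupied//.
rewrite mem_cat; case: (x \in s); case: (x \in t); rewrite ?mul0e ?mule0//.
exact: Ucat.
Qed.

(** By multiplicativity, the other particles only contribute factors at most
    [1]. *)
Lemma avoid_occupied_mem x y k s : y \in s ->
  avoid K (occupied x) k s <= avoid K (occupied x) k [:: y].
Proof.
have W0 t : 0 <= avoid K (occupied x) k t.
  by apply: avoid_ge0; exact: bmc_kernel_ge0.
have W1 t : avoid K (occupied x) k t <= 1.
  by apply: avoid_le1 => //; exact: bmc_kernel_ge0.
move=> /splitPr[s1 s2].
rewrite -cat1s !(avoid_occupied_multiplicative x k).2 muleA muleAC.
rewrite -[leRHS]mul1e; apply: lee_wpmul2r => //.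
apply: le_trans (W1 s1); rewrite -[leRHS]mule1.
by apply: lee_wpmul2l.
Qed.

Lemma kstep_ge0 k x y : 0 <= kstep p k x y.
Proof.
elim: k x => [|k IH] x /=; first by rewrite lee_fin.
by apply: esum_ge0 => z _; rewrite mule_ge0 ?lee_fin.
Qed.

(** If [p] can go from [y] to [x] in [k] steps, then it has a first step to some
    [z] from which [k - 1] steps suffice; the first particle takes that step with
    positive probability. *)
Lemma avoid_occupied_lt1 x y k : 0 < kstep p k y x ->
  avoid K (occupied x) k [:: y] < 1.
Proof.
elim: k y => [|k IH] y /=; rewrite mem_occupied mem_seq1 eq_sym.
  by case: eqP => // _; rewrite ltxx.
move=> k0; case: ifP => // _.
have [z pz kz] : exists2 z, (0 < p y z)%R & 0 < kstep p k z x.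
  apply: contrapT => nz; move: k0; rewrite esum1 ?ltxx// => z _.
  have [->|pz] := eqVneq (p y z) 0%R; first by rewrite mul0e.
  have [->|kz] := eqVneq (kstep p k z x) 0; first by rewrite mule0.
  by case: nz; exists z; [rewrite lt0r pz p0|rewrite lt0e kz kstep_ge0].
have W0 t : 0 <= avoid K (occupied x) k t.
  by apply: avoid_ge0; exact: bmc_kernel_ge0.
have W1 t : avoid K (occupied x) k t <= 1.
  by apply: avoid_le1 => //; exact: bmc_kernel_ge0.
have Wf t : avoid K (occupied x) k t \is a fin_num.
  by apply: avoid_fin_num => //; exact: bmc_kernel_ge0.
apply: (@le_lt_trans _ _ (\esum_(z in [set: X])
    ((p y z)%:E * avoid K (occupied x) k [:: z]))).
  apply: (@esum_bmc_kernel_head_le y [::] _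
    (fun z => avoid K (occupied x) k [:: z])) => //.
  by move=> z' l; apply: avoid_occupied_mem; rewrite mem_head.
(* the term of index [z] is strictly smaller on the left, the others are not
   larger *)
rewrite -[ltRHS](p1 y) (esumID [set z])//; last first.
  by move=> z' _; rewrite mule_ge0 ?lee_fin.
rewrite [ltRHS](esumID [set z])//; last by move=> z' _; rewrite lee_fin.
rewrite !setTI !esum_set1 ?lee_fin ?mule_ge0 ?lee_fin//.
have rest_le z' : (p y z')%:E * avoid K (occupied x) k [:: z'] <= (p y z')%:E.
  by rewrite -[leRHS]mule1; apply: lee_wpmul2l; rewrite ?lee_fin.
apply: lte_leD.
- rewrite ge0_fin_numE; last first.
    by apply: esum_ge0 => z' _; rewrite mule_ge0 ?lee_fin.
  apply: (@le_lt_trans _ _ 1); last exact: ltry.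
  rewrite -(p1 y) [leRHS](esumID [set z])//; last first.
    by move=> z' _; rewrite lee_fin.
  rewrite !setTI; apply: le_trans (_ : _ <= \esum_(i in ~` [set z]) (p y i)%:E) _.
    exact: le_esum.
  by rewrite leeDr// esum_set1 lee_fin.
- by rewrite -[ltRHS]mule1 lte_pmul2l// IH.
- exact: le_esum.
Qed.

End Branching.

(** * Strong recurrence *)

(** Each configuration is finite, so only infinitely many visited times can make
    the total infinite; conversely a convergent series has tails below [1],
    whereas each visited time contributes at least [1]. *)
Lemma infinite_total_visits (R : realType) (X : countType) (T : Type)
    (Z : nat -> T -> seq X) (x : X) :
  [set w | \sum_(1 <= n <oo) \sum_(y <- Z n w) ((y == x)%:R)%:E
           = +oo :> \bar R] =
  visits_io Z (occupied x).
Proof.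
apply/seteqP; split => w /=;
  pose u n : \bar R := \sum_(y <- Z n w) ((y == x)%:R)%:E;
  have u0 n : 0 <= u n by apply: sume_ge0 => y _; rewrite lee_fin.
- move=> uoo; rewrite visits_ioE => -[N _ mi]; move: uoo.
  have uN n : (N <= n)%N -> u n = 0.
    move=> Nn; rewrite /u big_seq big1// => y yZ; case: eqP => // yx.
    by case: (mi n Nn); rewrite /occupied /= -yx.
  rewrite (nneseries_split 1 N) => [|n _]; last exact: u0.
  rewrite [X in _ + X]eseries0 ?adde0; last first.
    by move=> n Nn _; apply: uN; rewrite (leq_trans _ Nn)// leq_addl.
  move=> uoo; have : \sum_(1 <= n < 1 + N) u n \is a fin_num.
    by apply/sum_fin_numP => n _ _; apply/sum_fin_numP => y _ _.
  by rewrite /u uoo.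
- move=> io; apply: contrapT => /eqP; rewrite -ltey => fin1.
  have fin0 : \sum_(0 <= n <oo) u n < +oo.
    rewrite nneseries_recl//; apply: lte_add_pinfty => //.
    by rewrite -ge0_fin_numE//; apply/sum_fin_numP => y _ _.
  suff : 1 <= 0 :> \bar R by rewrite lee_fin ler10.
  apply: (cvge_to_ge (nneseries_tail_cvg fin0 (fun k _ => u0 k))).
  apply: nearW => N; have [n Nn xZ] := io N.
  apply: le_trans (nneseries_lim_ge n.+1 (fun k _ _ => u0 k)).
  rewrite big_nat_recr//=; apply: (@le_trans _ _ (u n)).
    rewrite /u (big_rem x)//= eqxx leeDl//.
    by apply: sume_ge0 => y _; rewrite lee_fin.
  by rewrite leeDr// sume_ge0.
Qed.

Theorem lemma3p4 (R : realType) (X : countType) (p : X -> X -> R)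
    (mu : X -> nat -> R)
    (hX : infinite_set [set: X])
    (hp : stochastic p) (hirr : irreducible p)
    (hmu : offspring_distribution mu)
    (* the Markov chain (X, P) *)
    (dY : measure_display) (TY : measurableType dY)
    (PY : X -> probability TY R) (Y : nat -> TY -> X)
    (hY : forall x, markov_chain (PY x) p x Y)
    (* the branching Markov chain (X, P, mu) *)
    (dZ : measure_display) (TZ : measurableType dZ)
    (PZ : X -> probability TZ R) (Z : nat -> TZ -> seq X)
    (hZ : branching_markov_chain p mu PZ Z)
    (c : R) (hc : (0 < c)%R)
    (hC : recurrent_set PY Y [set x | c%:E <= alpha PZ Z x]) :
  strongly_recurrent PZ Z.
Proof.
set C := [set x | c%:E <= alpha PZ Z x] in hC.
pose K := bmc_kernel p mu.
have K0 := bmc_kernel_ge0 hp hmu.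
have hZx x : markov_chain (PZ x) K [:: x] Z := hZ x.
have alphaE x : alpha PZ Z x = PZ x (visits_io Z (occupied x)).
  by rewrite /alpha infinite_total_visits.
(* infinitely many visits to [x] force infinitely many visits to [a] *)
have hit_le x a : alpha PZ Z x <= PZ x (visits_io Z (occupied a)).
  rewrite alphaE; have [k k0] := hirr x a.
  have W0 : 0 <= avoid K (occupied a) k [:: x] by exact: avoid_ge0.
  have W1 := avoid_occupied_lt1 hp hmu k0.
  have Wfin : avoid K (occupied a) k [:: x] \is a fin_num.
    by rewrite ge0_fin_numE//; exact: lt_trans (ltry 1).
  apply: (le_visits_io K0 (hZx x) (r := fine (avoid K (occupied a) k [:: x]))).
    by rewrite fine_ge0//= -lte_fin fineK.
  move=> s xs; exists k; rewrite fineK//; exact: avoid_occupied_mem.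
have C_io x : PY x (visits_io Y C) = 1.
  have mio := measurable_visits_io (hY x) C.
  apply: probability_eq1 => //.
  apply: negligibleS (hC x) => w /=; apply: contra_not => inf N.
  apply: contrapT => nN; apply: inf; apply: (@sub_finite_set _ _ `I_N) => //.
  by move=> n /= Cn; rewrite ltnNge; apply/negP => Nn; apply: nN; exists n.
move=> x; apply/eqP; rewrite eq_le alphaE probability_le1 /=; last first.
  exact: measurable_visits_io (hZx x) _.
have nonempty : PZ x (visits_io Z [set s | s != [::]]) = 1.
  apply: (visits_io_closed (hZx x)) => // -[|y s] // t _ /negP.
  rewrite negbK => /eqP ->.
  rewrite /K /= big_ord_recl big_ord0 addr0 /litter_prob /=.
  by have [_ -> _ _] := hmu y; rewrite !mul0r.
rewrite -nonempty.
(* from any configuration, the first particle reaches [C] almost surely; any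
   bound [r < 1] on the avoidance probability would do *)
apply: (@le_trans _ _ (PZ x (visits_io Z (headed C)))).
  apply: (le_visits_io K0 (hZx x) (r := (2^-1)%R)).
    by rewrite invr_ge0 ler0n invf_lt1 ?ltr1n.
  move=> [|y s] // _.
  have [k Wk] : exists k, avoid p C k y <= (2^-1)%R%:E.
    apply: (avoid_le_visits_io _ (hY y) (c := 1%R)).
    - exact: hp.1.
    - by rewrite subrr invr_gt0.
    - by rewrite C_io.
  exists k; apply: le_trans Wk; exact: avoid_headed_le.
(* the first particle, when in [C], reaches [x] with probability at least [c];
   half of it is given up to reach [x] within finitely many steps, and the
   maximum with [0] covers [c > 2] *)
apply: (le_visits_io K0 (hZx x) (r := Num.max 0%R (1 - c / 2)%R)).
  by rewrite le_max lexx gt_max ltr01 gtrBl divr_gt0.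
move=> [|y s] //= Cy.
have [k Wk] : exists k,
    avoid K (occupied x) k [:: y] <= (Num.max 0%R (1 - c / 2)%R)%:E.
  apply: (avoid_le_visits_io K0 (hZx y) (c := c)); last first.
    exact: le_trans Cy (hit_le _ _).
  rewrite lt_max; apply/orP; right.
  by rewrite ltrD2l ltrN2 ltr_pdivrMr// ltr_pMr// ltr1n.
exists k; apply: le_trans Wk.
by apply: avoid_occupied_mem => //; rewrite mem_head.
Qed.
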